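(* There does not exist a system of $61$ equiangular lines in $\mathbb{R}^{18}$. Equivalently, $N(18) \leqslant 60$, i.e. every equiangular line system in $\mathbb{R}^{18}$ has cardinality at most $60$.
   Context: A system of (distinct) lines $\{l_1,\dots,l_n\}$ through the origin in $\mathbb{R}^d$, where each $l_i$ is spanned by a unit vector $\mathbf{v}_i$, is called equiangular if there exists a constant $\alpha>0$ such that $\langle \mathbf{v}_i,\mathbf{v}_j\rangle = \pm\alpha$ for all $i\neq j$. $N(d)$ denotes the maximum cardinality of a system of equiangular lines in $\mathbb{R}^d$. *)

(* Defs.v *)
From mathcomp Require Import all_boot all_order all_algebra.
From mathcomp Require Import reals.

Set Implicit Arguments.
Unset Strict Implicit.
Unset Printing Implicit Defensive.

Import Order.TTheory GRing.Theory Num.Theory.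
Local Open Scope ring_scope.

Definition dot (R : realType) (d : nat) (u v : 'rV[R]_d) : R :=
  \sum_(i < d) u 0 i * v 0 i.

(* A system of n lines is a family indexed by 'I_n; injectivity says that the
   lines are distinct.  Each line is the subspace spanned by a unit vector, so
   that it is one-dimensional. *)
Definition equiangular (R : realType) (d n : nat)
    (l : 'I_n -> {vspace 'rV[R]_d}) : Prop :=
  injective l /\
  exists (v : 'I_n -> 'rV[R]_d) (alpha : R),
    [/\ forall i, dot (v i) (v i) = 1,
        forall i, l i = <[v i]>%VS,
        0 < alpha &
        forall i j, i != j ->
          dot (v i) (v j) = alpha \/ dot (v i) (v j) = - alpha].

(* N is the maximum N(d).  It is a relation because the existence of the
   maximum is itself a theorem. *)
Definition is_max_equiangular (R : realType) (d N : nat) : Prop :=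
  (exists l : 'I_N -> {vspace 'rV[R]_d}, equiangular l) /\
  (forall (n : nat) (l : 'I_n -> {vspace 'rV[R]_d}),
     equiangular l -> (n <= N)%N).

(* Main.v *)
Require Import Defs.
From mathcomp Require Import all_boot all_order all_algebra.
From mathcomp Require Import reals.
From mathcomp Require Import boolp algC algnum complex.
From mathcomp Require Import ring lra zify.

(* Suppose 61 lines with common cosine alpha span at most 18 dimensions, let V
   be the 61 x 18 matrix of unit vectors, and put a = 1/alpha, G = a V V^T, so that G
   has diagonal a and off-diagonal entries +1 or -1, and B = a V^T V.
   - Since G = a + S has corank at least 43 > 61/2, the number -a is a root of
     the integral polynomial char_poly S of multiplicity more than half its
     degree, so a is an integer (Neumann).
   - (tr B)^2 <= 18 tr(B^2) gives a <= 5.  If a is even then, modulo 2,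
     char_poly G = X (X - 1)^60, which is not divisible by X^43.  If a = 1 then
     the lines coincide.
   - a = 3 (Lemmens and Seidel): three vectors with Gram products -1 split the
     remaining ones into three pillars; projected orthogonally to the three
     vectors, each pillar becomes a subset of a root system of type A1^r.
   - a = 5: C = B - 17 has tr(C^2) = 17, and char_poly B is integral and equal
     to X^17 (X - 1) modulo 2.  By AM-GM, C has eigenvalue 0 exactly once and
     all its other eigenvalues are 1 or -1, so that M = 1 - C^2 is a projection
     of rank 1.  Then N = a V M V^T = 34 G^2 - 288 G - G^3 is integral, positive
     semidefinite, of trace 17, with odd diagonal entries: its trace is at least
     61, a contradiction. *)

Set Implicit Arguments.
Unset Strict Implicit.
Unset Printing Implicit Defensive.

Import Order.TTheory GRing.Theory Num.Theory.
Local Open Scope ring_scope.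

(** * Characteristic polynomials and integrality *)

(** Block triangular factors on the right and on the left both turn [N] into a block triangular
    matrix; comparing the two determinants gives Sylvester's identity. *)
Lemma char_poly_mulmxC (K : comNzRingType) (m n : nat)
    (A : 'M[K]_(m, n)) (B : 'M[K]_(n, m)) :
  'X^n * char_poly (A *m B) = 'X^m * char_poly (B *m A).
Proof.
pose PA : 'M[{poly K}]_(m, n) := map_mx polyC A.
pose PB : 'M[{poly K}]_(n, m) := map_mx polyC B.
pose N : 'M[{poly K}]_(m + n) := block_mx 'X%:M PA PB 1%:M.
have detN : \det N = char_poly (A *m B).
  rewrite -[LHS]mulr1 -[X in _ * X](_ : \det (block_mx 1%:M 0 (- PB) 1%:M) = _).
    rewrite -det_mulmx mulmx_block !mulmx1 !mulmx0 !mul1mx mulmxN addrN !add0r.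
    by rewrite det_ublock det1 mulr1 -map_mxM.
  by rewrite det_lblock !det1 mulr1.
have : \det (block_mx 1%:M 0 (- PB) 'X%:M *m N) = 'X^m * char_poly (B *m A).
  rewrite mulmx_block !mul1mx !mul0mx !addr0 mulmx1 mulNmx.
  rewrite scalar_mxC addNr det_ublock det_scalar; congr (_ * \det _).
  by rewrite mulNmx -map_mxM addrC.
by rewrite det_mulmx detN det_lblock det1 mul1r det_scalar.
Qed.

Lemma char_poly_add_scalar (K : comNzRingType) (n : nat) (A : 'M[K]_n) (c : K) :
  char_poly (A + c%:M) = char_poly A \Po ('X - c%:P).
Proof.
rewrite /char_poly -(det_map_mx (comp_poly ('X - c%:P))); congr (\det _).
apply/matrixP => i j; rewrite !mxE rmorphB rmorphMn /=.
rewrite comp_polyX comp_polyC rmorphD rmorphMn /=.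
by rewrite mulrnBl opprD addrA addrAC.
Qed.

(** Neumann's argument: [t] is a simple root of its minimal polynomial [q] over the rationals, so
    the k-th power of [q] divides [p]. As [p] has degree below [2k], [q] is linear; a rational
    algebraic integer is an integer. *)
Lemma int_root_of_mult (F : numFieldType) (p : {poly int}) (t : F) (k : nat) :
  p \is monic -> (size p <= k.*2)%N ->
  ('X - t%:P) ^+ k %| map_poly intr p -> exists z : int, t = z%:~R.
Proof.
move=> p_monic sp dvd_p.
pose f := map_poly (ratr : rat -> F).
have pQ : map_poly intr p = f (map_poly intr p).
  by rewrite /f -map_poly_comp; apply: eq_map_poly => z /=; rewrite ratr_int.
set P := map_poly intr p : {poly rat} in pQ.
have P_monic : P \is monic by rewrite monic_map.
have P0 : P != 0 by exact: monic_neq0.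
have k0 : (0 < k)%N.
  by case: k sp {dvd_p} => //; rewrite leqNgt size_poly_gt0 monic_neq0.
have rP : root (f P) t.
  rewrite -dvdp_XsubCl -pQ; apply: dvdp_trans dvd_p.
  by rewrite -{1}['X - _]expr1 dvdp_exp2l.
have ex : exists n, `[< exists q : {poly rat}, [/\ q != 0, size q = n & root (f q) t] >].
  by exists (size P); apply/asboolP; exists P.
case: (ex_minnP ex) => n /asboolP[q [q0 sq rq]] minq.
have min_dvd r : root (f r) t -> q %| r.
  move=> rr; apply/modp_eq0P/eqP; apply: contraT => m0.
  have : (n <= size (r %% q)%R)%N.
    apply: minq; apply/asboolP; exists (r %% q); split => //.
    move: rr; rewrite {1}(divp_eq r q) /f rmorphD rmorphM /= !rootE hornerD hornerM.
    by move: rq; rewrite /root => /eqP ->; rewrite mulr0 add0r.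
  by rewrite -sq leqNgt ltn_modp q0.
have fq0 : f q != 0 by rewrite map_poly_eq0.
have sq2 : (1 < size q)%N.
  by rewrite -(size_map_poly (ratr : {rmorphism rat -> F})); apply: root_size_gt1 rq.
(* A double root would also be a root of the derivative, which is nonzero and smaller than [q]. *)
have mupq : mup t (f q) = 1%N.
  apply/eqP; rewrite eqn_leq -XsubC_dvd // dvdp_XsubCl rq andbT mup_leq //.
  apply/negP => /dvdpP[r fqE].
  have dq0 : q^`() != 0.
    apply/eqP => /(congr1 (fun r : {poly rat} => r`_(size q).-2)).
    rewrite coef_deriv coef0 -subn2 -addn1.
    have -> : (size q - 2 + 1 = (size q).-1)%N by lia.
    by move/eqP; rewrite mulrn_eq0 -lead_coefE lead_coef_eq0 (negPf q0); lia.
  have : (n <= size q^`())%N.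
    apply: minq; apply/asboolP; exists q^`(); split => //.
    rewrite /f -deriv_map -/(f q) fqE expr2 !derivM !derivXsubC rootE.
    by rewrite !(hornerD, hornerM, hornerXsubC, hornerN, hornerX, hornerC) ?subrr !(mulr0, mul0r, addr0).
  by rewrite leqNgt -sq lt_size_deriv.
(* Each division by [q] lowers the multiplicity of [t] by exactly one. *)
have key j Q : Q != 0 -> (j <= mup t (f Q))%N -> (j * (size q).-1 <= (size Q).-1)%N.
  elim: j Q => [//|j IH] Q Q0 jQ.
  have fQ0 : f Q != 0 by rewrite map_poly_eq0.
  have rQ : root (f Q) t by rewrite -dvdp_XsubCl XsubC_dvd //; apply: leq_trans jQ.
  have /dvdpP[Q' QE] := min_dvd _ rQ.
  have Q'0 : Q' != 0 by apply: contraNneq Q0; rewrite QE => ->; rewrite mul0r.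
  have fQ'0 : f Q' != 0 by rewrite map_poly_eq0.
  have /IH : (j <= mup t (f Q'))%N.
    by move: jQ; rewrite QE /f rmorphM /= mupM // -/f mupq addn1.
  move=> /(_ Q'0) le1.
  rewrite QE size_mul // mulSn; move: le1 sq2 Q'0; rewrite -size_poly_gt0.
  move: (size q) (size Q') => x y; move: (j * x.-1)%N => w. lia.
have sqE : size q = 2.
  have : (k * (size q).-1 <= (size P).-1)%N by apply: key => //; rewrite mup_geq ?map_poly_eq0 // -pQ.
  have -> : size P = size p by rewrite size_map_inj_poly //; exact: intr_inj.
  by nia.
pose r := - (q`_0 / q`_1).
have q1 : q`_1 != 0 by rewrite (_ : q`_1 = lead_coef q) ?lead_coef_eq0 // lead_coefE sqE.
have tE : t = ratr r.
  move: rq; rewrite /root horner_coef size_map_poly sqE big_ord_recl big_ord1 /=.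
  rewrite !coef_map /= expr0 expr1 mulr1 => /eqP h.
  have q1' : ratr q`_1 != 0 :> F by rewrite fmorph_eq0.
  rewrite /r rmorphN fmorph_div /=; apply: (mulfI q1').
  by rewrite mulrN mulrCA mulfV // mulr1; apply/eqP; rewrite -addr_eq0 addrC h.
have rootr : root P r.
  by move: rP; rewrite tE /root /f horner_map fmorph_eq0.
have : (ratr r : algC) \in Num.int.
  apply: Cint_rat_Aint; first exact: Crat_rat.
  apply: (@root_monic_Aint (map_poly ratr P)).
  - by rewrite fmorph_root.
  - by rewrite map_monic.
  - apply/polyOverP => i; rewrite !coef_map /= ratr_int; exact: intr_int.
case/intrP => z rz; exists z; rewrite tE.
suff -> : r = z%:~R by rewrite ratr_int.
by apply: (fmorph_inj (ratr : {rmorphism rat -> algC})); rewrite /= rz ratr_int.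
Qed.

Lemma char_poly_mulmx_idomain (K : idomainType) (n d : nat)
    (A : 'M[K]_(n, d)) (B : 'M[K]_(d, n)) :
  (d <= n)%N -> char_poly (A *m B) = 'X^(n - d) * char_poly (B *m A).
Proof.
move=> le_dn; apply: (@mulfI _ ('X^d)); first by rewrite monic_neq0 ?monicXn.
by rewrite char_poly_mulmxC mulrA -exprD subnKC.
Qed.

Lemma char_poly_const_mx1 (K : idomainType) (n : nat) :
  char_poly (const_mx 1 : 'M[K]_n.+1) = 'X^n * ('X - n.+1%:R%:P).
Proof.
have -> : const_mx 1 = (const_mx 1 : 'M[K]_(n.+1, 1)) *m const_mx 1 :> 'M[K]_n.+1.
  by apply/matrixP => i j; rewrite !mxE big_ord1 !mxE mulr1.
rewrite char_poly_mulmx_idomain // subn1 /=; congr (_ * _).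
rewrite /char_poly det_mx11 !mxE (eq_bigr (fun=> 1)) => [|i _]; last first.
  by rewrite !mxE mulr1.
by rewrite sumr_const card_ord.
Qed.

(** The factor ['X^(n - d)] of [char_poly (A *m B)] makes [- a] a root of [char_poly S] of
    multiplicity at least [n - d], more than half the degree. *)
Lemma Neumann_int (F : numFieldType) (n d : nat) (S : 'M[int]_n) (a : F)
    (A : 'M[F]_(n, d)) (B : 'M[F]_(d, n)) :
  (d.*2 < n)%N -> A *m B = map_mx intr S + a%:M -> exists z : int, a = z%:~R.
Proof.
move=> lt_dn AB.
have [|||z za] := @int_root_of_mult F (char_poly S) (- a) (n - d).
- exact: char_poly_monic.
- by rewrite size_char_poly; lia.
- have -> : map_poly intr (char_poly S) = char_poly (A *m B) \Po ('X + a%:P).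
    rewrite AB char_poly_add_scalar -comp_polyA comp_polyB comp_polyX comp_polyC.
    by rewrite addrK comp_polyXr map_char_poly.
  rewrite char_poly_mulmx_idomain; last by lia.
  by rewrite comp_polyM comp_Xn_poly polyCN opprK dvdp_mulr.
by exists (- z); rewrite rmorphN /= -za opprK.
Qed.

(** The entries of [B *m A] need not be integers, yet its characteristic polynomial is integral,
    being the cofactor of a power of ['X] in [char_poly G]. *)
Lemma int_char_poly_factor (F : numFieldType) (n d : nat) (G : 'M[int]_n)
    (A : 'M[F]_(n, d)) (B : 'M[F]_(d, n)) :
  (d <= n)%N -> A *m B = map_mx intr G ->
  exists q : {poly int}, char_poly G = 'X^(n - d) * q /\
    map_poly intr q = char_poly (B *m A).
Proof.
move=> le_dn AB.
have GE : map_poly intr (char_poly G) = 'X^(n - d) * char_poly (B *m A).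
  by rewrite -char_poly_mulmx_idomain // AB map_char_poly.
have GX : char_poly G = 'X^(n - d) * drop_poly (n - d) (char_poly G).
  rewrite mulrC -{1}[char_poly G](poly_take_drop (n - d)).
  rewrite [X in X + _](_ : _ = 0) ?add0r //; apply/polyP => i.
  rewrite coef_take_poly coef0; case: ltnP => // lt_i.
  apply: (@intr_inj F); rewrite -[LHS]coef_map GE coefXnM lt_i.
  by [].
exists (drop_poly (n - d) (char_poly G)); split => //.
apply: (@mulfI _ ('X^(n - d))); first by rewrite monic_neq0 ?monicXn.
by rewrite -GE {2}GX rmorphM /= map_polyXn.
Qed.

(** Modulo 2 the polynomial [q] becomes ['X^(n - k) * ('X - 1)], whose derivative at 1 is 1. This
    yields the nonzero derivative that the AM-GM argument requires. *)
Lemma odd_gram_deriv (n k : nat) (q : {poly int}) (G : 'M[int]_n.+1) (c : int) :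
  (k <= n)%N -> n.+1%:R = 1 :> 'F_2 -> c%:~R = 1 :> 'F_2 ->
  char_poly G = 'X^k * q -> map_mx intr G = const_mx 1 :> 'M['F_2]_n.+1 ->
  (q^`().[c])%:~R = 1 :> 'F_2.
Proof.
move=> le_kn n1 c1 Gq G1.
have qE : map_poly intr q = 'X^(n - k) * ('X - 1%:P) :> {poly 'F_2}.
  apply: (@mulfI _ ('X^k)); first by rewrite monic_neq0 ?monicXn.
  have := congr1 (map_poly (intr : int -> 'F_2)) Gq.
  rewrite map_char_poly G1 char_poly_const_mx1 rmorphM /= map_polyXn => <-.
  by rewrite n1 mulrA -exprD subnKC.
rewrite -[LHS]horner_map /= -deriv_map qE c1 derivM derivXsubC mulr1.
by rewrite hornerD hornerM hornerXsubC subrr mulr0 add0r hornerXn expr1n.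
Qed.

(** Modulo 2 the characteristic polynomial is ['X * ('X - 1)^n], which ['X^2] does not divide. *)
Lemma even_gram_false (n k : nat) (q : {poly int}) (G : 'M[int]_n.+1) :
  (1 < k)%N -> n.+1%:R = 1 :> 'F_2 ->
  char_poly G = 'X^k * q ->
  map_mx intr G = const_mx 1 + 1%:M :> 'M['F_2]_n.+1 -> False.
Proof.
move=> lt1k n1 Gq G1.
have := congr1 (map_poly (intr : int -> 'F_2)) Gq.
rewrite map_char_poly G1 char_poly_add_scalar char_poly_const_mx1 [RHS]rmorphM /= map_polyXn.
rewrite comp_polyM comp_Xn_poly comp_polyB comp_polyX comp_polyC -addrA -opprD -polyCD.
rewrite n1 (_ : 1 + 1 = 0 :> 'F_2); last exact: val_inj.
rewrite subr0 mulrC -(subnKC lt1k) exprD expr2 -!mulrA => /mulfI.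
rewrite polyX_eq0 => /(_ isT) /(congr1 (horner^~ 0)).
rewrite hornerM hornerX mul0r horner_exp hornerXsubC sub0r => /eqP.
by rewrite expf_eq0 oppr_eq0 oner_eq0 andbF.
Qed.

(** * Symmetric matrices with integral characteristic polynomial *)

(** Cauchy-Schwarz on the diagonal: by symmetry, the trace of the square is the sum of the squares
    of all entries. *)
Lemma sqr_trace_le (F : realFieldType) (d : nat) (B : 'M[F]_d) :
  B^T = B -> (\tr B) ^+ 2 <= d%:R * \tr (B *m B).
Proof.
move=> symB.
have le_diag : \sum_i B i i ^+ 2 <= \tr (B *m B).
  apply: ler_sum => i _; rewrite mxE (bigD1 i) //= -expr2 lerDl.
  by apply: sumr_ge0 => j _; rewrite -{2}symB mxE -expr2 sqr_ge0.
apply: le_trans (ler_wpM2l (ler0n _ _) le_diag).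
set t := \tr B; set s := \sum_i _.
have [d0 | d_gt0] := posnP d.
  by subst d; rewrite mul0r /t /mxtrace big_ord0 expr0n.
have : 0 <= \sum_i (d%:R * B i i - t) ^+ 2.
  by apply: sumr_ge0 => i _; rewrite sqr_ge0.
rewrite (eq_bigr (fun i => d%:R ^+ 2 * B i i ^+ 2 - 2 * d%:R * t * B i i + t ^+ 2)).
  rewrite big_split /= sumrB -!mulr_sumr sumr_const card_ord.
  rewrite -/s -/(mxtrace B) -/t.
  rewrite (_ : _ + _ = d%:R * (d%:R * s - t ^+ 2)); last by ring.
  by rewrite pmulr_rge0 ?ltr0n // subr_ge0.
by move=> i _; ring.
Qed.

(* AM-GM twice: the product of the [mu i] is an integer of absolute value less
   than 1, hence 0; the product of the others is a nonzero integer (it is the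
   derivative up to sign), hence the equality case holds. *)
Lemma integral_near_one (K : numFieldType) (n : nat) (mu : 'I_n.+1 -> K)
    (c : int) (q : {poly int}) :
  (forall i, mu i \is Num.real) -> \sum_i mu i ^+ 2 = n%:R ->
  map_poly intr q = \prod_i ('X - (mu i + c%:~R)%:P) -> q^`().[c] != 0 ->
  forall i, mu i ^+ 3 = mu i.
Proof.
move=> mu_real sum_mu qE dq0.
have mu2_ge0 i : 0 <= mu i ^+ 2 by rewrite -realEsqr.
have int_sq_ge1 (z : int) : z != 0 -> 1 <= (z%:~R : K) ^+ 2.
  move=> z0; rewrite -rmorphXn /= -[1]/(1%:~R) ler_int.
  by move: z0; nia.
have qc : (q.[c])%:~R = \prod_i (- mu i).
  rewrite -[LHS]horner_map qE horner_prod; apply: eq_bigr => i _ /=.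
  by rewrite !hornerE opprD addrCA subrr addr0.
(* The product of the n+1 squares is at most [(n / (n + 1))^(n + 1) < 1]. *)
have q0 : q.[c] = 0.
  apply/eqP; apply: contraT => /int_sq_ge1.
  rewrite qc -prodrXl.
  have [+ _] := @leif_AGM _ _ predT (fun i => mu i ^+ 2) (fun i _ => mu2_ge0 i).
  rewrite card_ord sum_mu => h1 h2.
  have : 1 <= (n%:R / n.+1%:R : K) ^+ n.+1.
    apply: le_trans h1; apply: le_trans h2 _.
    by rewrite (eq_bigr _ (fun i _ => sqrrN (mu i))).
  rewrite expr_ge1 ?divr_ge0 ?ler0n // ler_pdivlMr ?ltr0n // mul1r ler_nat.
  by rewrite ltnn.
have [i0 mu0] : exists i0, mu i0 = 0.
  move: qc; rewrite q0 => /esym/eqP /prodf_eq0[i _]; rewrite oppr_eq0 => /eqP.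
  by exists i.
have sum_mu' : \sum_(i | i != i0) mu i ^+ 2 = n%:R.
  by rewrite -sum_mu [RHS](bigD1 i0) //= mu0 expr0n add0r.
have card' : #|predC1 i0| = n by rewrite cardC1 card_ord.
(* Since the factor of [i0] vanishes at [c], only its derivative contributes. *)
have dqc : (q^`().[c])%:~R = \prod_(i | i != i0) (- mu i).
  rewrite -[LHS]horner_map -deriv_map qE (bigD1 i0) //= derivM derivXsubC.
  rewrite hornerD !hornerM hornerXsubC mu0 add0r subrr mul0r addr0 hornerC mul1r.
  rewrite horner_prod; apply: eq_bigr => i _ /=.
  by rewrite !hornerE opprD addrCA subrr addr0.
have [le_prod eq_prod] := @leif_AGM _ _ (predC1 i0) (fun i => mu i ^+ 2) (fun i _ => mu2_ge0 i).
have n0 : (0 < n)%N \/ n = 0%N by lia.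
case: n0 => n0; last first.
  by subst n => i; move: mu0; rewrite !ord1 => ->; rewrite expr0n.
rewrite card' sum_mu' divff ?pnatr_eq0 -?lt0n // expr1n in le_prod eq_prod.
have prod1 : \prod_(i in predC1 i0) mu i ^+ 2 == 1.
  rewrite eq_le le_prod; have := int_sq_ge1 _ dq0; rewrite dqc -prodrXl.
  by rewrite (eq_bigr _ (fun i _ => sqrrN (mu i))).
move: prod1; rewrite eq_prod => /forall_inP all_eq.
move=> i; have [->|ii0] := eqVneq i i0; first by rewrite mu0 expr0n.
have mui : mu i ^+ 2 = 1.
  have /forall_inP alli := all_eq i ii0.
  move: sum_mu'; rewrite (eq_bigr (fun=> mu i ^+ 2)); last first.
    by move=> j jj0; apply/esym/eqP; apply: alli.
  rewrite sumr_const card' => h.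
  apply: (@mulfI _ n%:R); first by rewrite pnatr_eq0 -lt0n.
  by rewrite mulr_natl h mulr1.
by rewrite exprS mui mulr1.
Qed.

(** The spectral theorem over [R[i]] diagonalises [C] with real eigenvalues, and [integral_near_one]
    applies to them. *)
Lemma symmetric_cube_eq (R : rcfType) (n : nat) (C : 'M[R]_n.+1) (c : int)
    (q : {poly int}) :
  C^T = C -> \tr (C *m C) = n%:R ->
  map_poly intr q = char_poly (C + c%:~R%:M) -> q^`().[c] != 0 ->
  C *m C *m C = C.
Proof.
move=> symC trC qE dq0.
pose f := real_complex R; pose CC := map_mx f C.
have CC_real : CC \is a realmx.
  by apply/mxOverP => i j; rewrite mxE realE -[0]/(f 0) !lecR -realE num_real.
have CC_sym : CC \is symmetricmx.
  by apply/is_hermitianmxP; rewrite expr0 scale1r; apply/matrixP => i j; rewrite !mxE -{1}symC mxE.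
have CC_herm := realsym_hermsym CC_sym CC_real.
have /orthomx_spectralP := symmetric_normalmx CC_sym CC_real.
have := hermitian_spectral_diag_real CC_herm.
have := spectral_unit CC.
move: (spectralmx CC) (spectral_diag CC) => P D Pu D_real CCE.
have D3 : forall i, D 0 i ^+ 3 = D 0 i.
  apply: (@integral_near_one _ _ (fun i => D 0 i) c q) => //.
  - by move=> i; apply: (mxOverP D_real).
  - have -> : n%:R = \tr (CC *m CC) by rewrite -map_mxM trace_map_mx trC rmorph_nat.
    rewrite CCE !mulmxA mulmxK // -!mulmxA mxtrace_mulC !mulmxA mulmxK //.
    rewrite mulmx_diag mxtrace_diag.
    by apply: eq_bigr => i _; rewrite !mxE expr2.
  - have -> : map_poly intr q = map_poly f (map_poly intr q) :> {poly R[i]}.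
      by rewrite -map_poly_comp; apply: eq_map_poly => z /=; rewrite rmorph_int.
    rewrite qE map_char_poly map_mxD map_scalar_mx /= rmorph_int -/CC CCE.
    have -> : invmx P *m diag_mx D *m P + c%:~R%:M = invmx P *m (diag_mx D + c%:~R%:M) *m P.
      by rewrite mulmxDr mulmxDl scalar_mxC mulmxKV.
    transitivity (char_poly (diag_mx D + c%:~R%:M)).
      by rewrite -mulmxA char_poly_mulmx_idomain // subnn mul1r mulmxK.
    rewrite char_poly_trig; last by apply/is_trig_mxP => i j lt_ij; rewrite !mxE -val_eqE ltn_eqF // !mulr0n addr0.
    by apply: eq_bigr => i _; rewrite !mxE eqxx !mulr1n.
have map_f_inj : injective (map_mx f : _ -> 'M_n.+1) by exact: map_mx_inj.
apply: map_f_inj; rewrite !map_mxM -/CC.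
rewrite CCE !mulmxA !mulmxK // -!mulmxA; congr (_ *m _); rewrite !mulmxA; congr (_ *m _).
rewrite !mulmx_diag; congr diag_mx; apply/rowP => i; rewrite !mxE.
by rewrite -[RHS]D3 exprS expr2 mulrA.
Qed.

(** * Gram matrices with off-diagonal entries 1 and -1 *)

(** The Gram matrix of unit vectors divided by the common cosine [1/a], that is, [a] plus a Seidel
    matrix. *)
Definition sign_gram (n : nat) (a : int) (G : 'M[int]_n) : Prop :=
  [/\ G^T = G, forall i, G i i = a &
      forall i j, i != j -> G i j = 1 \/ G i j = -1].

Lemma sign_gram_trace (n : nat) (a : int) (G : 'M[int]_n) :
  sign_gram a G -> \tr G = a *+ n.
Proof.
case=> _ diagG _; rewrite /mxtrace (eq_bigr (fun=> a)) => [|i _]; last exact: diagG.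
by rewrite sumr_const card_ord.
Qed.

Lemma sign_gram_trace_sqr (n : nat) (a : int) (G : 'M[int]_n.+1) :
  sign_gram a G -> \tr (G *m G) = (a ^+ 2 + n%:R) *+ n.+1.
Proof.
case=> symG diagG offG; rewrite /mxtrace (eq_bigr (fun=> a ^+ 2 + n%:R)) => [|i _].
  by rewrite sumr_const card_ord.
rewrite mxE (bigD1 i) //= diagG -expr2; congr (_ + _).
rewrite (eq_bigr (fun=> 1)) => [|j ji]; last first.
  by rewrite -{2}symG mxE; have [|->|->] := offG i j; rewrite ?mulrNN ?mulr1 // eq_sym.
by rewrite sumr_const cardC1 card_ord.
Qed.

Lemma sign_gram_F2 (n : nat) (a : int) (G : 'M[int]_n) (b : 'F_2) :
  sign_gram a G -> a%:~R = 1 + b -> map_mx intr G = const_mx 1 + b%:M :> 'M['F_2]_n.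
Proof.
case=> symG diagG offG ab; apply/matrixP => i j; rewrite !mxE.
have [<-|ij] := eqVneq i j; first by rewrite diagG ab.
rewrite mulr0n addr0.
by have [->|->] := offG _ _ ij; apply: val_inj.
Qed.

Lemma sign_gram_F2_odd (n : nat) (a : int) (G : 'M[int]_n) :
  sign_gram a G -> a%:~R = 1 :> 'F_2 -> map_mx intr G = const_mx 1 :> 'M['F_2]_n.
Proof.
move=> gramG a1; rewrite (sign_gram_F2 (b := 0) gramG) ?addr0 //.
by rewrite (raddf0 (@scalar_mx _ _)) addr0.
Qed.

Lemma mulmx_const_mx1_odd (n : nat) :
  n%:R = 1 :> 'F_2 -> (const_mx 1 : 'M_n) *m const_mx 1 = const_mx 1 :> 'M['F_2]_n.
Proof.
move=> n1; apply/matrixP => j k; rewrite !mxE (eq_bigr (fun=> 1)) => [|l _]; last first.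
  by rewrite !mxE mulr1.
by rewrite sumr_const card_ord n1.
Qed.

Lemma idempotent_compl_sqr (K : nzRingType) (n : nat) (C : 'M[K]_n) :
  C *m C *m C = C -> (1%:M - C *m C) *m (1%:M - C *m C) = 1%:M - C *m C.
Proof.
by move=> C3; rewrite mulmxBl !mulmxBr !mul1mx !mulmx1 !mulmxA C3 subrr subr0.
Qed.

(** * Exclusion of the common cosine 1/5 *)

Section FiveGram.
Variables (R : rcfType) (V : 'M[R]_(61, 18)) (G : 'M[int]_61).
Hypotheses (gramG : sign_gram 5 G) (VG : 5 *: (V *m V^T) = map_mx intr G).

Let W := 5 *: V^T.
Let B := W *m V.
(** The mean eigenvalue of [B] is 305/18, and 17 is the nearest integer. *)
Let C := B - 17%:M.

Let VW : V *m W = map_mx intr G.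
Proof. by rewrite -scalemxAr. Qed.

Let symB : B^T = B.
Proof. by rewrite /B /W trmx_mul linearZ /= trmxK -scalemxAr -scalemxAl. Qed.

Let symC : C^T = C.
Proof. by rewrite /C linearB /= tr_scalar_mx symB. Qed.

Let trB : \tr B = 305.
Proof.
rewrite mxtrace_mulC VW trace_map_mx (sign_gram_trace gramG).
by rewrite rmorphMn /=; ring.
Qed.

Let trBB : \tr (B *m B) = 5185.
Proof.
rewrite /B mulmxA mxtrace_mulC !mulmxA VW -mulmxA VW -map_mxM trace_map_mx.
by rewrite (sign_gram_trace_sqr gramG) rmorphMn rmorphD rmorphXn /=; ring.
Qed.

(** The value is one less than the order 18, exactly what [symmetric_cube_eq] needs. *)
Let trCC : \tr (C *m C) = 17.
Proof.
rewrite /C mulmxBl !mulmxBr mul_mx_scalar !mul_scalar_mx.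
rewrite !linearB /= !linearZ /= mxtrace_scalar trB trBB; ring.
Qed.

Let C3 : C *m C *m C = C.
Proof.
have [|q [Gq qB]] := @int_char_poly_factor _ 61 18 G V W _ VW; first by [].
have c1 : (17 : int)%:~R = 1 :> 'F_2 by exact: val_inj.
have n1 : 61%:R = 1 :> 'F_2 by exact: val_inj.
apply: (@symmetric_cube_eq R 17 C 17 q symC trCC).
  have -> : C + 17%:~R%:M = B by exact: subrK.
  exact: qB.
apply/eqP => dq0.
have five1 : (5 : int)%:~R = 1 :> 'F_2 by exact: val_inj.
have G1 := sign_gram_F2_odd gramG five1.
have := @odd_gram_deriv 60 43 q G 17 isT n1 c1 Gq G1.
by rewrite dq0.
Qed.

Let M := 1%:M - C *m C.

Lemma five_gram_false : False.
Proof.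
have symM : M^T = M by rewrite /M linearB /= trmx1 trmx_mul symC.
have idM : M *m M = M.
  exact: idempotent_compl_sqr C3.
(* With [V *m C = (G - 17) *m V], the product [V *m M *m W] equals [G - (G - 17)^2 G]; expanding
   gives these coefficients. *)
pose N : 'M[int]_61 := 34 *: (G *m G) - 288 *: G - G *m G *m G.
have NE : map_mx intr N = V *m M *m W.
  set X := map_mx intr G : 'M[R]_61.
  have VC : V *m C = (X - 17%:M) *m V.
    by rewrite /C /B mulmxBr mulmxBl mulmxA VW scalar_mxC.
  rewrite /M mulmxBr mulmx1 mulmxBl VW mulmxA VC -(mulmxA _ V) VC mulmxA -(mulmxA _ V) VW -/X.
  rewrite /N !map_mxB !map_mxZ !map_mxM -/X.
  rewrite !(mulmxBl, mulmxBr) !mul_mx_scalar !mul_scalar_mx -?scalemxAl ?mul_scalar_mx -?scalemxAl.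
  by move: (X *m X *m X) (X *m X) => X3 X2; apply/matrixP => i j; rewrite !mxE; ring.
have N_ge0 i : 0 <= N i i.
  rewrite -(ler_int R) -[X in _ <= X]/(intr (N i i)).
  have -> : (N i i)%:~R = (map_mx intr N : 'M[R]_61) i i by rewrite [RHS]mxE.
  have -> : map_mx intr N = 5 *: ((V *m M) *m (V *m M)^T).
    by rewrite NE /W -scalemxAr trmx_mul symM mulmxA -[in RHS](mulmxA V M) idM.
  rewrite !mxE mulr_ge0 // sumr_ge0 // => k _.
  by rewrite [X in _ * X]mxE -expr2 sqr_ge0.
(* Modulo 2, [G] is the all-ones matrix, which is idempotent in odd order; the even coefficients
   vanish and [N] is all ones too. *)
have N_odd i : N i i != 0.
  have five1 : (5 : int)%:~R = 1 :> 'F_2 by exact: val_inj.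
  have n1 : 61%:R = 1 :> 'F_2 by exact: val_inj.
  have G1 := sign_gram_F2_odd gramG five1.
  have J2 := mulmx_const_mx1_odd n1.
  have : map_mx intr N i i = 1 :> 'F_2.
    rewrite /N !map_mxB !map_mxZ !map_mxM G1 !J2 !mxE.
    exact: val_inj.
  by rewrite mxE; apply: contra_eq_neq => ->; rewrite eq_sym oner_eq0.
(* Cyclicity gives the trace of [M *m B]; as [M *m C = 0], it is 17 times the trace of [M], which is
   18 - 17 = 1. *)
have trN : \tr N = 17.
  apply: (@intr_inj R); rewrite -trace_map_mx NE -mulmxA mxtrace_mulC -mulmxA -/B.
  have -> : B = C + 17%:M by rewrite /C subrK.
  rewrite mulmxDr {1}/M mulmxBl mul1mx C3 subrr add0r mul_mx_scalar linearZ /=.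
  by rewrite /M linearB /= mxtrace1 trCC; ring.
have : \sum_(i < 61) 1 <= \tr N.
  by apply: ler_sum => i _; rewrite -gtz0_ge1 lt_neqAle eq_sym N_odd N_ge0.
by rewrite trN sumr_const card_ord.
Qed.
End FiveGram.

(** * Common cosine 1/3 *)

Section Pillars.
Variables (R : realType) (d : nat).
Local Notation V := 'rV[R]_d.
Implicit Types (u v w : V) (I : finType).

(* Unit vectors with products 1/3 or -1/3 have [dot3 v v = 3] and mutual products 1 or -1. *)
Definition dot3 u v : R := 3 * dot u v.

Lemma dot3C u v : dot3 u v = dot3 v u.
Proof. by congr (_ * _); apply: eq_bigr => i _; rewrite mulrC. Qed.

Lemma dot3Dl u v w : dot3 (u + v) w = dot3 u w + dot3 v w.
Proof.
by rewrite -mulrDr -big_split; congr (_ * _); apply: eq_bigr => i _; rewrite mxE mulrDl.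
Qed.

Lemma dot3Zl (a : R) u w : dot3 (a *: u) w = a * dot3 u w.
Proof.
rewrite /dot3 mulrCA; congr (_ * _); rewrite mulr_sumr.
by apply: eq_bigr => i _; rewrite mxE mulrA.
Qed.

Lemma dot3Nl u w : dot3 (- u) w = - dot3 u w.
Proof. by rewrite -scaleN1r dot3Zl mulN1r. Qed.

Lemma dot3Dr u v w : dot3 w (u + v) = dot3 w u + dot3 w v.
Proof. by rewrite !(dot3C w) dot3Dl. Qed.

Lemma dot3Zr (a : R) u w : dot3 w (a *: u) = a * dot3 w u.
Proof. by rewrite !(dot3C w) dot3Zl. Qed.

Lemma dot3Nr u w : dot3 w (- u) = - dot3 w u.
Proof. by rewrite !(dot3C w) dot3Nl. Qed.

Lemma dot3_suml I (P : pred I) (F : I -> V) w :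
  dot3 (\sum_(i | P i) F i) w = \sum_(i | P i) dot3 (F i) w.
Proof.
apply: (big_morph (fun u => dot3 u w)) => [u v|]; first exact: dot3Dl.
by rewrite -(scale0r 0) dot3Zl mul0r.
Qed.

Lemma dot3_sumr I (P : pred I) (F : I -> V) w :
  dot3 w (\sum_(i | P i) F i) = \sum_(i | P i) dot3 w (F i).
Proof. by rewrite dot3C dot3_suml; apply: eq_bigr => i _; rewrite dot3C. Qed.

Lemma dot3_ge0 u : 0 <= dot3 u u.
Proof. by rewrite mulr_ge0 ?ler0n // sumr_ge0 // => i _; rewrite -expr2 sqr_ge0. Qed.

Lemma dot3_eq0 u : dot3 u u = 0 -> u = 0.
Proof.
move/eqP; rewrite mulf_eq0 pnatr_eq0 /= psumr_eq0 => [/allP u0|i _]; last first.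
  by rewrite -expr2 sqr_ge0.
apply/rowP => i; rewrite mxE; apply/eqP.
by have := u0 i (mem_index_enum _); rewrite /= mulf_eq0 orbb.
Qed.

Definition dot3E := (dot3Dl, dot3Dr, dot3Nl, dot3Nr, dot3Zl, dot3Zr).

(* The hypotheses say that [c] lists roots of a root system of type A1^r. *)
Lemma A1_bessel I (T : {set I}) (c : I -> V) u :
  {in T, forall i, dot3 (c i) (c i) = 2} ->
  {in T &, forall i j, i != j -> dot3 (c i) (c j) = 0 \/ dot3 (c i) (c j) = -2} ->
  \sum_(i in T) dot3 u (c i) ^+ 2 <= 4 * dot3 u u.
Proof.
move=> c2 cc; pose a i := dot3 u (c i).
pose w := \sum_(i in T) a i *: c i.
have opp i j : i \in T -> j \in T -> dot3 (c i) (c j) = -2 -> c j = - c i.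
  move=> iT jT cij; apply/eqP; rewrite -addr_eq0; apply/eqP/dot3_eq0.
  rewrite !dot3E (dot3C (c j) (c i)) cij !c2 //; ring.
(* Besides the diagonal, only an opposite root [c j = - c i] contributes, and it adds another
   [2 * a i ^+ 2]. *)
have row_le i : i \in T -> \sum_(j in T) a i * a j * dot3 (c i) (c j) <= 4 * a i ^+ 2.
  move=> iT; rewrite (bigD1 i) //= c2 //.
  have [/existsP[j /and3P[jT ji /eqP cij]] | none] :=
      boolP [exists j, [&& j \in T, j != i & dot3 (c i) (c j) == -2]].
    rewrite (bigD1 j) ?jT //= big1 => [|k /andP[/andP[kT ki] kj]].
      by rewrite cij /a (opp i j) // dot3Nr; nra.
    have [|->|cik] := cc i k iT kT; [by rewrite eq_sym | by rewrite mulr0 |].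
    have [ckj|ckj] := cc k j kT jT kj.
      by move: ckj; rewrite (opp i j) // (opp i k) // !dot3E c2 //; lra.
    by move: ckj; rewrite (opp i j) // (opp i k) // !dot3E c2 //; lra.
  rewrite big1 => [|k /andP[kT ki]]; first by nra.
  have [|->|cik] := cc i k iT kT; [by rewrite eq_sym | by rewrite mulr0 |].
  by case/negP: none; apply/existsP; exists k; rewrite kT ki cik eqxx.
have ww : dot3 w w <= 4 * \sum_(i in T) a i ^+ 2.
  rewrite /w dot3_suml mulr_sumr; apply: ler_sum => i iT.
  apply: le_trans (row_le i iT); rewrite dot3_sumr.
  by rewrite le_eqVlt; apply/orP; left; apply/eqP/eq_bigr => j _; rewrite !dot3E mulrA.
have uw : dot3 u w = \sum_(i in T) a i ^+ 2.
  by rewrite dot3_sumr; apply: eq_bigr => i _; rewrite dot3Zr expr2.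
(* The factor 1/4 is optimal for [dot3 w w <= 4 * dot3 u w]. *)
have := dot3_ge0 (u - 4^-1 *: w).
rewrite !dot3E (dot3C w u) uw; move: ww; rewrite -/(a _); set A := \sum_(i in T) _; lra.
Qed.

(** Bessel's inequality summed over the standard basis: each root contributes 6 and each basis
    vector allows 12. *)
Lemma A1_card_le I (T : {set I}) (c : I -> V) :
  {in T, forall i, dot3 (c i) (c i) = 2} ->
  {in T &, forall i j, i != j -> dot3 (c i) (c j) = 0 \/ dot3 (c i) (c j) = -2} ->
  (#|T| <= d.*2)%N.
Proof.
move=> c2 cc.
pose e (k : 'I_d) : V := delta_mx 0 k.
have ek k v : dot3 (e k) v = 3 * v 0 k.
  rewrite /dot3 /dot (bigD1 k) //= big1 => [|j jk]; rewrite !mxE ?eqxx ?mul1r ?addr0 //.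
  by rewrite (negPf jk) mul0r.
have : \sum_(k < d) \sum_(i in T) dot3 (e k) (c i) ^+ 2 <= \sum_(k < d) 12.
  apply: ler_sum => k _; apply: le_trans (A1_bessel _ c2 cc) _.
  by rewrite ek mxE !eqxx /=; lra.
rewrite exchange_big /= (eq_bigr (fun=> 6)) => [|i iT]; last first.
  rewrite (_ : 6 = 3 * dot3 (c i) (c i)); last by rewrite c2 //; ring.
  by rewrite [in RHS]/dot3 /dot !mulr_sumr; apply: eq_bigr => k _; rewrite ek; ring.
rewrite !sumr_const card_ord -[6 *+ _]mulr_natr -[12 *+ _]mulr_natr => h.
by rewrite -(ler_nat R) -muln2 natrM; lra.
Qed.

Lemma A1_card_le8 I (T : {set I}) (c : I -> V) u :
  {in T, forall i, dot3 (c i) (c i) = 2} ->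
  {in T &, forall i j, i != j -> dot3 (c i) (c j) = 0 \/ dot3 (c i) (c j) = -2} ->
  dot3 u u = 2 -> {in T, forall i, dot3 u (c i) = 1 \/ dot3 u (c i) = -1} ->
  (#|T| <= 8)%N.
Proof.
move=> c2 cc u2 uc; have := A1_bessel u c2 cc.
rewrite u2 (eq_bigr (fun=> 1)) => [|i iT]; last first.
  by have [->|->] := uc i iT; rewrite ?sqrrN expr1n.
by rewrite sumr_const -(ler_nat R); lra.
Qed.

(** The pillar [T k] collects the vectors over [h k]; subtracting [h k] projects them orthogonally
    to all the [h l] and yields roots of norm 2. The last nonempty pillar has at most [2d] elements,
    the others at most 8 each. *)
Lemma pillar_card I (D : {set I}) (y : I -> V) (h : 'I_3 -> V) :
  (forall k l, dot3 (h k) (h l) = (k == l)%:R) ->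
  {in D, forall i, dot3 (y i) (y i) = 3} ->
  {in D &, forall i j, i != j -> dot3 (y i) (y j) = 1 \/ dot3 (y i) (y j) = -1} ->
  {in D, forall i, exists k, forall l, dot3 (y i) (h l) = (l == k)%:R} ->
  (#|D| <= d.*2 + 16)%N.
Proof.
move=> hh y3 yy yh.
pose T k := [set i in D | dot3 (y i) (h k) == 1].
have TD k i : i \in T k -> i \in D by rewrite inE => /andP[].
have Th k l i : i \in T k -> dot3 (y i) (h l) = (l == k)%:R.
  rewrite inE => /andP[iD]; have [m hm] := yh i iD; rewrite !hm.
  by case: (eqVneq k m) => [-> //|_]; rewrite eq_sym oner_eq0.
pose c k i := y i - h k.
have c2 k : {in T k, forall i, dot3 (c k i) (c k i) = 2}.
  move=> i iT; rewrite !dot3E (dot3C (h k)) !(Th k) // hh !eqxx y3 ?(TD k) //; rewrite mulr1n; ring.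
have cc k : {in T k &, forall i j, i != j ->
    dot3 (c k i) (c k j) = 0 \/ dot3 (c k i) (c k j) = -2}.
  move=> i j iT jT ij; rewrite !dot3E (dot3C (h k)) !(Th k) // hh !eqxx mulr1n.
  by have [->|->] := yy i j (TD k i iT) (TD k j jT) ij; [left | right]; ring.
have le_2d k : (#|T k| <= d.*2)%N := A1_card_le (@c2 k) (@cc k).
(* One root from [T l] has products 1 or -1 with all roots from [T k], because [h k] and [h l] are
   orthogonal. *)
have le_8 k l : k != l -> #|T l| = 0%N \/ (#|T k| <= 8)%N.
  move=> kl; have [->|[j jT]] := set_0Vmem (T l); first by left; rewrite cards0.
  right; apply: (A1_card_le8 (@c2 k) (@cc k) (c2 l j jT)) => i iT.
  rewrite !dot3E !(dot3C (h l)) (Th k l i iT) (Th l k j jT) hh ?(eq_sym l k) !(negPf kl) !mulr0n !subr0.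
  have ij : j != i.
    apply: contraNneq kl => ji; subst j; have := Th l k i jT.
    by rewrite (Th k k i iT) eqxx; case: (k == l) => // /eqP; rewrite oner_eq0.
  by have [->|->] := yy j i (TD l j jT) (TD k i iT) ij; [left | right].
pose k0 : 'I_3 := 0; pose k1 : 'I_3 := 1; pose k2 : 'I_3 := 2%:R.
have le_D : (#|D| <= #|T k0| + #|T k1| + #|T k2|)%N.
  apply: leq_trans (leq_trans (leq_card_setU (T k0 :|: T k1) (T k2)) _); last first.
    by rewrite leq_add2r leq_card_setU.
  apply/subset_leq_card/subsetP => i iD; rewrite !inE iD /=.
  have [k hk] := yh i iD; rewrite !hk.
  by case: k {hk} => [[|[|[|k]]] lt_k3] //=; rewrite eqxx ?orbT.
have := le_8 k0 k1 isT; have := le_8 k0 k2 isT; have := le_8 k1 k2 isT.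
have := le_2d k0; have := le_2d k1; have := le_2d k2.
by lia.
Qed.

(** The Gram matrix is twice the identity plus the all-ones matrix, hence nonsingular, so the
    vectors are independent. *)
Lemma unit_gram_card (n : nat) (y : 'I_n -> V) :
  (forall i, dot3 (y i) (y i) = 3) -> (forall i j, i != j -> dot3 (y i) (y j) = 1) ->
  (n <= d)%N.
Proof.
move=> y3 y1; pose Y : 'M[R]_(n, d) := \matrix_i y i.
suff /eqP <- : row_free Y by exact: rank_leq_col.
rewrite -kermx_eq0; apply/eqP/row_matrixP => k; rewrite row0.
have : row k (kermx Y) *m Y = 0 by rewrite -row_mul mulmx_ker row0.
move: (row k _) => c; rewrite mulmx_sum_row => cY.
have ci i : 2 * c 0 i + \sum_j c 0 j = 0.
  have := congr1 (dot3 (y i)) cY; rewrite dot3_sumr (bigD1 i) //= [in RHS]/dot3 /dot.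
  rewrite [in RHS]big1 ?mulr0 => [|j _]; last by rewrite mxE mulr0.
  rewrite dot3Zr rowK y3 (eq_bigr (c 0)) => [|j ji]; last first.
    by rewrite dot3Zr rowK y1 ?mulr1 // eq_sym.
  by move=> h; rewrite (bigD1 i) //=; lra.
have s0 : \sum_j c 0 j = 0.
  have : \sum_i (2 * c 0 i + \sum_j c 0 j) = 0 by rewrite big1.
  rewrite big_split /= -mulr_sumr sumr_const card_ord -[_ *+ n]mulr_natl -mulrDl.
  by move/eqP; rewrite -natrD mulf_eq0 pnatr_eq0 => /eqP.
by apply/rowP => i; rewrite mxE; have := ci i; rewrite s0; lra.
Qed.

End Pillars.

(** * The Lemmens-Seidel count by switching signs *)

Section ThreeAngle.
Variables (R : realType) (d n : nat) (x : 'I_n -> 'rV[R]_d).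
Hypothesis x3 : forall i, dot3 (x i) (x i) = 3.
Hypothesis xx : forall i j, i != j -> dot3 (x i) (x j) = 1 \/ dot3 (x i) (x j) = -1.

Let sqr_xx i j : i != j -> dot3 (x i) (x j) * dot3 (x i) (x j) = 1.
Proof. by case/xx => ->; ring. Qed.

Lemma negative_triple_card (i1 i2 i3 : 'I_n) :
  i1 != i2 -> i1 != i3 -> i2 != i3 ->
  dot3 (x i1) (x i2) * dot3 (x i1) (x i3) * dot3 (x i2) (x i3) = -1 ->
  (n <= d.*2 + 20)%N.
Proof.
move=> i12 i13 i23 neg.
(* Sign changes give the [p]'s mutual products -1, and later every [y i] product 1 with [p1]. *)
pose p1 := x i1; pose p2 := - dot3 (x i1) (x i2) *: x i2.
pose p3 := - dot3 (x i1) (x i3) *: x i3.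
have p11 : dot3 p1 p1 = 3 by exact: x3.
have p22 : dot3 p2 p2 = 3 by rewrite /p2 !dot3E x3; have := sqr_xx i12; nra.
have p33 : dot3 p3 p3 = 3 by rewrite /p3 !dot3E x3; have := sqr_xx i13; nra.
have p12 : dot3 p1 p2 = -1 by rewrite /p2 !dot3E; have := sqr_xx i12; nra.
have p13 : dot3 p1 p3 = -1 by rewrite /p3 !dot3E; have := sqr_xx i13; nra.
have p23 : dot3 p2 p3 = -1 by rewrite /p2 /p3 !dot3E; rewrite -neg; ring.
pose y i := dot3 (x i) (x i1) *: x i.
pose D0 := ~: [set i1; i2; i3].
have D0P i : i \in D0 -> [/\ i != i1, i != i2 & i != i3].
  by rewrite !inE !negb_or => /andP[/andP[-> ->] ->].
have y3 i : i \in D0 -> dot3 (y i) (y i) = 3.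
  by case/D0P=> /sqr_xx h _ _; rewrite /y !dot3E x3; nra.
have yy : {in D0 &, forall i j, i != j -> dot3 (y i) (y j) = 1 \/ dot3 (y i) (y j) = -1}.
  move=> i j /D0P[/xx hi _ _] /D0P[/xx hj _ _] /xx hij; rewrite /y !dot3E.
  by move: hi hj hij => [->|->] [->|->] [->|->]; rewrite ?(mulr1, mul1r, mulrN, mulNr, opprK); auto.
have y_p1 i : i \in D0 -> dot3 (y i) p1 = 1.
  by case/D0P=> /sqr_xx h _ _; rewrite /y !dot3E.
have y_p2 i : i \in D0 -> dot3 (y i) p2 = 1 \/ dot3 (y i) p2 = -1.
  case/D0P=> /xx hi /xx hj _; rewrite /y /p2 !dot3E.
  by move: hi hj (xx i12) => [->|->] [->|->] [->|->]; rewrite ?(mulr1, mul1r, mulrN, mulNr, opprK); auto.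
have y_p3 i : i \in D0 -> dot3 (y i) p3 = 1 \/ dot3 (y i) p3 = -1.
  case/D0P=> /xx hi _ /xx hj; rewrite /y /p3 !dot3E.
  by move: hi hj (xx i13) => [->|->] [->|->] [->|->]; rewrite ?(mulr1, mul1r, mulrN, mulNr, opprK); auto.
clearbody y p1 p2 p3.
(* A vector with products 1 with all three [p]'s equals their sum, which has norm 3; there is at
   most one. *)
pose E := [set i in D0 | (dot3 (y i) p2 == 1) && (dot3 (y i) p3 == 1)].
have E1 : (#|E| <= 1)%N.
  have yE i : i \in E -> y i = p1 + p2 + p3.
    rewrite inE => /and3P[iD /eqP h2 /eqP h3]; apply/eqP; rewrite -subr_eq0; apply/eqP/dot3_eq0.
    rewrite !dot3E !(dot3C _ (y i)) (dot3C p2 p1) (dot3C p3 p1) (dot3C p3 p2).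
    by rewrite y3 // y_p1 // h2 h3 p11 p22 p33 p12 p13 p23; ring.
  apply/card_le1_eqP => i j iE jE; apply/eqP; apply: contraT => ij.
  have iD : i \in D0 by move: iE; rewrite inE => /andP[].
  have jD : j \in D0 by move: jE; rewrite inE => /andP[].
  by have := yy j i jD iD ij; rewrite (yE j) // -(yE i) // y3 // => -[]; lra.
(* An orthonormal basis of the span of the [p]'s, chosen so that each remaining sign pattern of
   [y i] has a single coordinate 1 and the others 0. *)
pose h (k : 'I_3) := nth 0 [:: 2^-1 *: (p1 + p2); 2^-1 *: (p1 + p3); - 2^-1 *: (p2 + p3)] k.
have hh k l : dot3 (h k) (h l) = (k == l)%:R.
  case: k l => [[|[|[|k]]] lk] [[|[|[|l]]] ll] //; rewrite /h /= !dot3E ?(dot3C p2 p1) ?(dot3C p3 p1) ?(dot3C p3 p2);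
  by rewrite ?p11 ?p22 ?p33 ?p12 ?p13 ?p23 /eq_op /=; lra.
have hy : {in D0 :\: E, forall i, exists k, forall l, dot3 (y i) (h l) = (l == k)%:R}.
  move=> i; rewrite in_setD => /andP[iE iD].
  have h1 := y_p1 i iD; have [h2|h2] := y_p2 i iD; have [h3|h3] := y_p3 i iD.
  - by move: iE; rewrite inE iD h2 h3 eqxx.
  - exists 0; case=> [[|[|[|l]]] ll] //; rewrite /h /= !dot3E ?h1 ?h2 ?h3 /eq_op /=; lra.
  - exists 1; case=> [[|[|[|l]]] ll] //; rewrite /h /= !dot3E ?h1 ?h2 ?h3 /eq_op /=; lra.
  - exists 2%:R; case=> [[|[|[|l]]] ll] //; rewrite /h /= !dot3E ?h1 ?h2 ?h3 /eq_op /=; lra.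
have := @pillar_card R d _ (D0 :\: E) y h hh.
have sub i : i \in D0 :\: E -> i \in D0 by rewrite in_setD => /andP[].
move=> /(_ (fun i iD => y3 i (sub i iD)) (fun i j iD jD => yy i j (sub i iD) (sub j jD)) hy).
have : (#|D0| <= #|D0 :\: E| + #|E|)%N.
  rewrite -(cardsID E D0) addnC leq_add2l subset_leq_card // subsetIr //.
have : (#|[set i1; i2; i3]| <= 3)%N.
  by apply: leq_trans (leq_card_setU _ _) _; rewrite cards1 cards2; case: (_ == _).
(* The total is [2d + 16] from the pillars, 1 from [E] and 3 from the triple. *)
have := cardsC [set i1; i2; i3]; rewrite card_ord -/D0.
by lia.
Qed.

(** If no triple has product -1, switching signs relative to one vector makes all products 1, and
    the vectors are independent. *)
Lemma three_angle_card : (n <= d.*2 + 20)%N.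
Proof.
have [/existsP[i1 /existsP[i2 /existsP[i3 /and4P[i12 i13 i23 /eqP neg]]]] | none] :=
  boolP [exists i1, exists i2, exists i3, [&& i1 != i2, i1 != i3, i2 != i3 &
    dot3 (x i1) (x i2) * dot3 (x i1) (x i3) * dot3 (x i2) (x i3) == -1]].
  exact: negative_triple_card neg.
have pos i1 i2 i3 : i1 != i2 -> i1 != i3 -> i2 != i3 ->
    dot3 (x i1) (x i2) * dot3 (x i1) (x i3) * dot3 (x i2) (x i3) = 1.
  move=> i12 i13 i23.
  have neg : dot3 (x i1) (x i2) * dot3 (x i1) (x i3) * dot3 (x i2) (x i3) != -1.
    apply: contraNneq none => neg; apply/existsP; exists i1; apply/existsP; exists i2.
    by apply/existsP; exists i3; rewrite i12 i13 i23 neg eqxx.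
  move: (xx i12) (xx i13) (xx i23) neg => [->|->] [->|->] [->|->];
  by rewrite ?(mulr1, mul1r, mulrN, mulNr, opprK) ?eqxx.
have [n0|n0] := posnP n; first by rewrite n0.
pose i0 := Ordinal n0.
pose s i := if i == i0 then 1 else dot3 (x i0) (x i).
have ss i : s i * s i = 1.
  by rewrite /s; case: eqVneq => [_|]; [rewrite mulr1 | rewrite eq_sym => /sqr_xx].
suff : (n <= d)%N by lia.
apply: (@unit_gram_card _ _ _ (fun i => s i *: x i)) => [i|i j ij]; rewrite !dot3E.
  by rewrite x3 mulrA ss mul1r.
rewrite /s; case: (eqVneq i i0) => [ii0|ii0].
  by rewrite -ii0 eq_sym (negPf ij) mul1r sqr_xx.
case: (eqVneq j i0) => [jj0|jj0].
  by rewrite -jj0 mul1r (dot3C (x i)) sqr_xx // eq_sym.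
by rewrite mulrA pos // eq_sym.
Qed.

End ThreeAngle.

(** * Equiangular systems *)

Lemma equiangular_sign_gram (R : realType) (d n : nat)
    (l : 'I_n -> {vspace 'rV[R]_d}) :
  equiangular l -> (d.*2 < n)%N -> (1 < n)%N ->
  exists (v : 'I_n -> 'rV[R]_d) (z : int) (G : 'M[int]_n),
    [/\ injective (fun i => <[v i]>%VS),
        z != 1,
        0 < z,
        forall i j, (G i j)%:~R = z%:~R * dot (v i) (v j) &
        sign_gram z G].
Proof.
case=> inj_l [v [alpha [v1 lv alpha0 vv]]] lt_dn lt1n.
pose V := \matrix_i v i : 'M[R]_(n, d).
have VV i j : (V *m V^T) i j = dot (v i) (v j).
  by rewrite mxE; apply: eq_bigr => k _; rewrite !mxE.
(* The Seidel matrix of the system, to which Neumann's argument applies. *)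
pose S : 'M[int]_n := \matrix_(i, j) if i == j then 0 else if dot (v i) (v j) == alpha then 1 else -1.
have alphaN : alpha != 0 by rewrite gt_eqF.
have VS : V *m (alpha^-1 *: V^T) = map_mx intr S + alpha^-1%:M.
  apply/matrixP => i j; rewrite -scalemxAr [LHS]mxE VV !mxE.
  have [<-|ij] := eqVneq i j; first by rewrite v1 mulr1 add0r.
  rewrite mulr0n addr0; case: eqP => [->|]; first by rewrite mulVf.
  by have [->//|-> _] := vv i j ij; rewrite mulrN mulVf.
have [z za] := Neumann_int lt_dn VS.
exists v, z, (S + z%:M); split.
- by move=> i j; rewrite -!lv; exact: inj_l.
(* With cosine 1, two of the unit vectors agree up to sign and span the same line. *)
- apply/eqP => z1; move: za; rewrite z1 => /(congr1 GRing.inv); rewrite invrK invr1 => alpha1.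
  pose i0 := Ordinal (ltnW lt1n); pose i1 := Ordinal lt1n.
  have i01 : i0 != i1 by [].
  case/eqP: i01; apply: inj_l; rewrite !lv.
  have dots i : dot3 (v i) (v i) = 3 by rewrite /dot3 v1 mulr1.
  have [] := vv i0 i1 isT; rewrite alpha1 => v01.
    have -> // : v i0 = v i1.
    apply/eqP; rewrite -subr_eq0; apply/eqP/dot3_eq0; rewrite !dot3E (dot3C (v i1)) !dots.
    by rewrite /dot3 v01; ring.
  have -> : v i0 = - v i1.
    apply/eqP; rewrite -subr_eq0; apply/eqP/dot3_eq0; rewrite !dot3E (dot3C (v i1)) !dots.
    by rewrite /dot3 v01; ring.
  by apply/eqP; rewrite eqEsubv -!memvE memvN memv_line -{1}[v i1]opprK memvN memv_line.
- by rewrite -(ltr_int R) -za invr_gt0.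
- move=> i j; rewrite -za -VV -[_ * _]/(alpha^-1 * _).
  move/matrixP/(_ i j): VS; rewrite -scalemxAr [LHS]mxE => ->.
  by rewrite !mxE rmorphD rmorphMn /= za.
split.
- rewrite linearD /= tr_scalar_mx; congr (_ + _); apply/matrixP => i j.
  rewrite !mxE eq_sym (_ : dot (v j) (v i) = dot (v i) (v j)) //.
  by apply: eq_bigr => k _; rewrite mulrC.
- by move=> i; rewrite !mxE eqxx add0r.
- move=> i j ij; rewrite !mxE (negPf ij) mulr0n addr0.
  by case: ifP; auto.
Qed.

Lemma no_equiangular_61 (R : realType) (l : 'I_61 -> {vspace 'rV[R]_18}) :
  ~ equiangular l.
Proof.
move=> eq_l.
have [//|//|v [z [G [inj_v z1 z0 Gv gramG]]]] := equiangular_sign_gram eq_l.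
pose V := \matrix_i v i : 'M[R]_(61, 18).
have VV i j : (V *m V^T) i j = dot (v i) (v j).
  by rewrite mxE; apply: eq_bigr => k _; rewrite !mxE.
have VG : z%:~R *: (V *m V^T) = map_mx intr G.
  by apply/matrixP => i j; rewrite [LHS]mxE VV -Gv [RHS]mxE.
clearbody V.
(* The trace inequality reads [(61 z)^2 <= 18 * 61 * (z^2 + 60)], that is, [43 z^2 <= 1080]. *)
have z5 : z <= 5.
  pose W := z%:~R *: V^T.
  have VW : V *m W = map_mx intr G by rewrite -scalemxAr.
  have symB : (W *m V)^T = W *m V.
    by rewrite /W trmx_mul linearZ /= trmxK -scalemxAr -scalemxAl.
  have := sqr_trace_le symB.
  have -> : \tr (W *m V) = z%:~R * 61.
    by rewrite mxtrace_mulC VW trace_map_mx (sign_gram_trace gramG) rmorphMn /= mulr_natr.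
  have -> : \tr (W *m V *m (W *m V)) = (z%:~R ^+ 2 + 60) * 61.
    rewrite mulmxA mxtrace_mulC !mulmxA VW -mulmxA VW -map_mxM trace_map_mx.
    rewrite (sign_gram_trace_sqr gramG) rmorphMn rmorphD rmorphXn /= -[LHS]mulr_natr.
    by [].
  have : 0 < z%:~R :> R by rewrite ltr0z.
  move=> _ h; rewrite leNgt; apply/negP => z6.
  have : (6 : int)%:~R <= z%:~R :> R by rewrite ler_int; lia.
  by nra.
have n1 : 61%:R = 1 :> 'F_2 by exact: val_inj.
have even_false : z%:~R = 0 :> 'F_2 -> False.
  move=> ze.
  have VW : V *m (z%:~R *: V^T) = map_mx intr G by rewrite -scalemxAr.
  have [|q [Gq _]] := @int_char_poly_factor _ 61 18 G V _ _ VW; first by [].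
  apply: (@even_gram_false 60 43 q G isT n1 Gq).
  by apply: (sign_gram_F2 gramG); rewrite ze; apply: val_inj.
have : z = 2 \/ z = 3 \/ z = 4 \/ z = 5 by lia.
case=> [z2|[z3|[z4|zz]]].
- by apply: even_false; rewrite z2; apply: val_inj.
- case: gramG => _ diagG offG.
  have dG i j : dot3 (v i) (v j) = (G i j)%:~R by rewrite Gv z3.
  suff : (61 <= 18.*2 + 20)%N by [].
  apply: (@three_angle_card R 18 61 v) => [i|i j ij]; rewrite dG.
    by rewrite diagG z3.
  by have [->|->] := offG i j ij; [left | right].
- by apply: even_false; rewrite z4; apply: val_inj.
- by apply: (@five_gram_false R V G); [rewrite -zz | rewrite -VG zz].
Qed.

Theorem mainTheorem1 (R : realType) :
  [/\ ~ (exists l : 'I_61 -> {vspace 'rV[R]_18}, equiangular l),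
      exists N : nat, is_max_equiangular R 18 N /\ (N <= 60)%N &
      forall (n : nat) (l : 'I_n -> {vspace 'rV[R]_18}),
        equiangular l -> (n <= 60)%N].
Proof.
have le60 (n : nat) (l : 'I_n -> {vspace 'rV[R]_18}) : equiangular l -> (n <= 60)%N.
  move=> [inj_l [v [alpha [v1 lv alpha0 vv]]]]; rewrite leqNgt; apply/negP => lt60.
  (* A larger system would contain one of exactly 61 lines. *)
  apply: (@no_equiangular_61 R (l \o widen_ord lt60)); split.
    by move=> i j /inj_l /(congr1 val) /= /val_inj.
  exists (v \o widen_ord lt60), alpha; split => [i|i||i j ij] //=; apply: vv.
  by apply: contraNneq ij => /(congr1 val) /= /val_inj ->.
split=> //; first by case=> l /no_equiangular_61.
pose P n := `[< exists l : 'I_n -> {vspace 'rV[R]_18}, equiangular l >].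
have exP : exists n, P n.
  (* The empty system makes the set of cardinalities nonempty; being bounded by 60, it has a
     maximum. *)
  exists 0%N; apply/asboolP; exists (fun=> 0%VS); split; first by case.
  by exists (fun=> 0), 1; split=> //; case.
have leP n : P n -> (n <= 60)%N by case/asboolP => l /le60.
case: (ex_maxnP exP leP) => N /asboolP exN maxN.
exists N; split; last by case: exN => l /le60.
by split=> // n l el; apply: maxN; apply/asboolP; exists l.
Qed.
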